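(* Let $g:\Omega\to\mathbb R$ be an arbitrary real-valued function and let $U_g=\sum_{x\in\Omega}e^{ig(x)}|x\rangle\langle x|$. Let $H$ be a Hamiltonian with ground-state energy $E_{\mathrm{gs}}$. For any normalized ansatz state $|\psi(\boldsymbol\theta)\rangle$, the post-processed state $|\psi_u(\boldsymbol\theta)\rangle=U_g|\psi(\boldsymbol\theta)\rangle$ is normalized and satisfies $$\langle\psi_u(\boldsymbol\theta)|H|\psi_u(\boldsymbol\theta)\rangle\ge E_{\mathrm{gs}} .$$ In particular, the exact value of the U-VQNHE objective $\langle\psi(\boldsymbol\theta)|U_g^\dagger H U_g|\psi(\boldsymbol\theta)\rangle$ is at least $E_{\mathrm{gs}}$ for every choice of $\boldsymbol\theta$ and $g$.
   Context: $\Omega=\{0,1\}^n$ indexes the computational orthonormal basis $\{|x\rangle\}_{x\in\Omega}$ of the $n$-qubit space $\mathbb C^{2^n}$. $H$ is a Hermitian operator on this space and $E_{\mathrm{gs}}$ is its smallest eigenvalue. $|\psi(\boldsymbol\theta)\rangle$ is a unit vector depending on circuit parameters $\boldsymbol\theta$. U-VQNHE (unitary variational quantum-neural hybrid eigensolver) uses as its exact objective the energy of $U_g|\psi(\boldsymbol\theta)\rangle$. *)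

(* Defs.v *)
From mathcomp Require Import all_boot all_order all_algebra.
From mathcomp Require Import complex.
From mathcomp Require Import all_classical all_reals all_analysis.

Set Implicit Arguments.
Unset Strict Implicit.
Unset Printing Implicit Defensive.

Import Order.TTheory GRing.Theory Num.Theory.

Local Open Scope ring_scope.
Local Open Scope complex_scope.
Local Open Scope sesquilinear_scope.

Notation bitstring n := (n.-tuple bool).

Lemma card_bitstring (n : nat) : #|{: bitstring n}| = (2 ^ n)%N.
Proof. by rewrite card_tuple card_bool. Qed.

(* The vector |x>: bitstrings are numbered by the canonical enumeration of the
   finite type {0,1}^n. *)
Definition ket (R : realType) (n : nat) (x : bitstring n) : 'cV[R[i]]_(2 ^ n) :=
  delta_mx (cast_ord (card_bitstring n) (enum_rank x)) 0.

(* Euler's formula: e^{it} for real t. *)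
Definition expi (R : realType) (t : R) : R[i] := cos t +i* sin t.

Definition phase_gate (R : realType) (n : nat) (g : bitstring n -> R)
    : 'M[R[i]]_(2 ^ n) :=
  \sum_(x : bitstring n) expi (g x) *: (ket R x *m (ket R x)^t*).

Definition braket (R : realType) (m : nat) (phi psi : 'cV[R[i]]_m) : R[i] :=
  (phi^t* *m psi) 0 0.

Definition normalized (R : realType) (m : nat) (psi : 'cV[R[i]]_m) : Prop :=
  braket psi psi = 1.

(* The order of R[i] relates only numbers with equal imaginary parts, so
   E%:C <= energy H psi says that the energy is real and at least E. *)
Definition energy (R : realType) (m : nat) (H : 'M[R[i]]_m) (psi : 'cV[R[i]]_m)
    : R[i] :=
  braket psi (H *m psi).

(* The smallest real eigenvalue; a Hermitian H has no other eigenvalues.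
   The library's eigenvalue is through row vectors, v *m H = a *: v, which gives
   the same spectrum as H *m v = a *: v. *)
Definition is_ground_energy (R : realType) (m : nat) (H : 'M[R[i]]_m) (E : R)
    : Prop :=
  eigenvalue H E%:C /\ (forall a : R, eigenvalue H a%:C -> E <= a).

Definition post_processed (R : realType) (n : nat) (g : bitstring n -> R)
    (psi : 'cV[R[i]]_(2 ^ n)) : 'cV[R[i]]_(2 ^ n) :=
  phase_gate g *m psi.

Definition uvqnhe_objective (R : realType) (n : nat) (H : 'M[R[i]]_(2 ^ n))
    (Theta : Type) (psi : Theta -> 'cV[R[i]]_(2 ^ n))
    (theta : Theta) (g : bitstring n -> R) : R[i] :=
  ((psi theta)^t* *m (phase_gate g)^t* *m H *m phase_gate g *m psi theta) 0 0.

Lemma is_ground_energy_exists (R : realType) (m : nat) (H : 'M[R[i]]_m) :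
  (0 < m)%N -> H \is hermsymmx -> exists E : R, is_ground_energy H E.
Proof.
move=> m0 hH; pose P := spectralmx H; pose d := spectral_diag H.
have hP : P \in unitmx := spectral_unit H.
have HE : P *m H = diag_mx d *m P.
  rewrite [H in LHS](orthomx_spectralP (hermitian_normalmx hH)).
  by rewrite !mulmxA mulmxV ?mul1mx.
have dre i : (complex.Re (d 0 i))%:C = d 0 i.
  by apply: RRe_real; apply: (mxOverP (hermitian_spectral_diag_real hH)).
pose k := [arg min_(i < Ordinal m0) complex.Re (d 0 i)]%O.
have kmin j : complex.Re (d 0 k) <= complex.Re (d 0 j).
  by rewrite /k; case: arg_minP => //= i _; apply.
exists (complex.Re (d 0 k)); split.
  rewrite dre; apply/eigenvalueP; exists (row k P).
    by rewrite -row_mul HE row_mul row_diag_mx -scalemxAl -rowE.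
  rewrite rowE; apply/eqP => r0.
  have /rowP/(_ k)/eqP : delta_mx 0 k = 0 :> 'rV[R[i]]_m.
    by rewrite -(mulmxK hP (delta_mx 0 k)) r0 mul0mx.
  by rewrite !mxE !eqxx oner_eq0.
move=> a /eigenvalueP [v Hv v0]; pose w := v *m invmx P.
have w0 : w != 0.
  apply: contraNneq v0 => w0; by rewrite -(mulmxKV hP v) -/w w0 mul0mx.
have [i wi] : exists i, w 0 i != 0.
  apply/existsP; apply: contraNT w0 => /existsPn h.
  by apply/eqP/rowP => i; have /negPn/eqP -> := h i; rewrite mxE.
have e : w *m diag_mx d = a%:C *: w.
  apply: (can_inj (mulmxK hP)).
  by rewrite -mulmxA -HE mulmxA mulmxKV // Hv -scalemxAl mulmxKV.
have := congr1 (fun M : 'rV_m => M 0 i) e; move: wi; clearbody w => wi.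
rewrite mul_mx_diag !mxE mulrC => /(mulIf wi) di.
by have := kmin i; rewrite di.
Qed.

(* Main.v *)
(* H is unitarily diagonalised, so its energy at a unit vector is an average of
   its eigenvalues with nonnegative weights of sum 1, hence at least the smallest
   one; U_g is diagonal with phases on the diagonal, hence unitary. *)
Require Import Defs.
From mathcomp Require Import all_boot all_order all_algebra.
From mathcomp Require Import complex.
From mathcomp Require Import all_classical all_reals all_analysis.

Import Order.TTheory GRing.Theory Num.Theory.
Local Open Scope ring_scope.
Local Open Scope complex_scope.

Local Open Scope sesquilinear_scope.

Lemma expi_mul_conj (R : realType) (t : R) : expi t * (expi t)^* = 1.
Proof.
apply/eqP; rewrite eq_complex /= mulrN opprK -!expr2 cos2Dsin2.
by rewrite mulrN [sin t * _]mulrC addNr !eqxx.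
Qed.

Lemma unitarymx_diag_mx (C : numClosedFieldType) (m : nat) (d : 'rV[C]_m) :
  (forall k, d 0 k * (d 0 k)^*%R = 1) -> diag_mx d \is unitarymx.
Proof.
move=> hd; apply/unitarymxP; rewrite tr_diag_mx map_diag_mx mul_diag_mx.
by apply/matrixP => i j; rewrite !mxE mulrnAr hd.
Qed.

(** Each projector $|x\rangle\langle x|$ is the diagonal matrix unit at the index of [x], so only
    the enumeration of bitstrings has to be matched with the matrix indices. *)
Lemma phase_gate_diag (R : realType) (n : nat) (g : bitstring n -> R) :
  phase_gate g = diag_mx (\row_k
    expi (g (enum_val (cast_ord (esym (card_bitstring n)) k)))).
Proof.
rewrite diag_mx_sum_delta /phase_gate.
rewrite (reindex (fun x => cast_ord (card_bitstring n) (enum_rank x))) /=; last first.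
  exists (fun k => enum_val (cast_ord (esym (card_bitstring n)) k)) => k _ /=.
    by rewrite cast_ordK enum_rankK.
  by rewrite enum_valK cast_ordKV.
apply: eq_bigr => x _; rewrite !mxE cast_ordK enum_rankK /ket.
by rewrite trmx_delta map_delta_mx mul_delta_mx.
Qed.

Lemma phase_gate_unitary {R : realType} {n : nat} (g : bitstring n -> R) :
  phase_gate g \is unitarymx.
Proof.
rewrite phase_gate_diag; apply: unitarymx_diag_mx => k.
by rewrite mxE; exact: expi_mul_conj.
Qed.

Lemma braket_unitary {R : realType} {m : nat} {U : 'M[R[i]]_m}
    (phi psi : 'cV[R[i]]_m) :
  U \is unitarymx -> braket (U *m phi) (U *m psi) = braket phi psi.
Proof.
move=> hU; rewrite /braket trmx_mul map_mxM -mulmxA (mulmxA (U^t*)).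
(* [unitarymxP] gives $UU^\dagger = 1$; for a square matrix this yields the needed $U^\dagger U =
   1$. *)
by rewrite (mulmx1C (unitarymxP hU)) mul1mx.
Qed.

(** By $PH = DP$, row [k] of [P] is a left eigenvector of [H] for the [k]-th diagonal entry, which
    is real because [H] is Hermitian; minimality of [E] then applies. *)
Lemma spectral_diag_ge (R : realType) (m : nat) (H : 'M[R[i]]_m) (E : R) :
    H \is hermsymmx -> is_ground_energy H E ->
  forall k, E%:C <= spectral_diag H 0 k.
Proof.
move=> hH [_ Emin] k; set d := spectral_diag H; set P := spectralmx H.
have hP : P \in unitmx := spectral_unit H.
have HE : P *m H = diag_mx d *m P.
  rewrite [H in LHS](orthomx_spectralP (hermitian_normalmx hH)).
  by rewrite !mulmxA mulmxV ?mul1mx.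
have dre : (complex.Re (d 0 k))%:C = d 0 k.
  by apply: RRe_real; apply: (mxOverP (hermitian_spectral_diag_real hH)).
rewrite -dre lecR; apply: Emin; rewrite dre.
apply/eigenvalueP; exists (row k P).
  by rewrite -row_mul HE row_mul row_diag_mx -scalemxAl -rowE.
(* The row is nonzero because [P] is invertible. *)
rewrite rowE mulmx_free_eq0 ?row_free_unit //.
by apply/eqP => /rowP/(_ k)/eqP; rewrite !mxE !eqxx oner_eq0.
Qed.

Lemma energy_ge_ground (R : realType) (m : nat) (H : 'M[R[i]]_m) (E : R)
    (phi : 'cV[R[i]]_m) :
    H \is hermsymmx -> is_ground_energy H E -> normalized phi ->
  E%:C <= energy H phi.
Proof.
move=> hH hE hphi; pose P := spectralmx H.
have hP : P \is unitarymx := spectral_unitarymx H.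
(* The coordinates of [phi] in an orthonormal eigenbasis of [H]; the weights of the average are
   $|w_k|^2$. *)
pose w := P *m phi.
have Ew : energy H phi = \sum_k spectral_diag H 0 k * (w k 0 * (w k 0)^*%R).
  rewrite /energy [in LHS](orthomx_spectralP (hermitian_normalmx hH)).
  (* Applying [P] to both arguments cancels the inverse in $H = P^{-1}DP$ and leaves $\langle
     w|D|w\rangle$. *)
  rewrite -(braket_unitary _ _ hP) -!mulmxA mulKVmx ?spectral_unit // -/P -/w.
  rewrite /braket mul_diag_mx mxE; apply: eq_bigr => k _.
  by rewrite !mxE mulrCA; congr (_ * _); exact: mulrC.
have w1 : \sum_k w k 0 * (w k 0)^*%R = 1.
  rewrite -hphi -(braket_unitary _ _ hP) /braket mxE; apply: eq_bigr => k _.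
  by rewrite !mxE mulrC.
(* Writing [E] as $\sum_k E\,|w_k|^2$ reduces the bound to a termwise comparison. *)
rewrite Ew -[E%:C]mulr1 -w1 mulr_sumr; apply: ler_sum => k _.
by apply: ler_wpM2r; [exact: mul_conjC_ge0 | exact: spectral_diag_ge].
Qed.

Theorem theorem3 (R : realType) (n : nat) (H : 'M[R[i]]_(2 ^ n)) (Egs : R)
    (hH : H \is hermsymmx) (hE : is_ground_energy H Egs)
    (Theta : Type) (psi : Theta -> 'cV[R[i]]_(2 ^ n))
    (hpsi : forall theta, normalized (psi theta)) :
  (forall (g : bitstring n -> R) (theta : Theta),
     normalized (post_processed g (psi theta)) /\
     Egs%:C <= energy H (post_processed g (psi theta))) /\
  (forall (theta : Theta) (g : bitstring n -> R),
     Egs%:C <= uvqnhe_objective H psi theta g).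
Proof.
have hpost g theta : normalized (post_processed g (psi theta)).
  rewrite /normalized (braket_unitary _ _ (phase_gate_unitary g)).
  exact: hpsi.
have hener g theta : Egs%:C <= energy H (post_processed g (psi theta)).
  exact: energy_ge_ground.
split=> [g theta | theta g]; first by [].
(* The two sides differ only by $(U_g\psi)^\dagger = \psi^\dagger U_g^\dagger$ and associativity. *)
have -> : uvqnhe_objective H psi theta g = energy H (post_processed g (psi theta)).
  by rewrite /energy /braket /post_processed trmx_mul map_mxM !mulmxA.
exact: hener.
Qed.
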